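(* Let $n$ be a positive integer, $T=O(1/n)$ with $T\le 1/n$, $\epsilon>0$, and suppose $\mathcal{N}^+,\mathcal{N}^-$ are two distributions over distributions on $[n]$ such that every distribution in the support of $\mathcal{N}^+$ is $T$-big, every distribution in the support of $\mathcal{N}^-$ is $\epsilon$-far from every $T$-big distribution, every such distribution assigns probability at most $p_{\max}$ to each element, and no algorithm can distinguish, with success probability $2/3$, a distribution drawn from $\mathcal{N}^+$ from one drawn from $\mathcal{N}^-$ using fewer than $s$ samples (as in the bigness lower-bound construction with these parameters). Then there exists a distribution over distributions on a matching poset with $n$ edges, whose distributions have maximum probability $p'_{\max}=\Theta(p_{\max})$, such that testing, with success probability $2/3$, whether a distribution randomly drawn from it is monotone or $\epsilon'=\Theta(\epsilon)$-far from any monotone distribution requires $s'=\Omega(s)$ samples.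
   Context: A distribution on $[n]$ is $T$-big if every element has probability at least $T$; $\epsilon$-far from $T$-big means total variation distance at least $\epsilon$ from every $T$-big distribution. A matching poset on $2n$ vertices has vertex set $\{u_1,\dots,u_n,v_1,\dots,v_n\}$ and $n$ vertex-disjoint directed edges $(v_i,u_i)$; a distribution $q$ on it is monotone if $q(v_i)\le q(u_i)$ for all $i$, and is $\epsilon$-far from monotone if its total variation distance to every monotone distribution is at least $\epsilon$. *)

(* Defs.v *)
From HB Require Import structures.
From mathcomp Require Import all_boot all_order all_algebra.
From mathcomp Require Import all_classical all_reals all_analysis.

Set Implicit Arguments.
Unset Strict Implicit.
Unset Printing Implicit Defensive.

Import Order.TTheory GRing.Theory Num.Theory.

Local Open Scope classical_set_scope.
Local Open Scope ring_scope.

#[short(type="finMeasurableType")]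
HB.structure Definition FinMeasurable (d : measure_display) :=
  {T of Finite T & Measurable d T}.

(* 'I_n.+1 rather than 'I_n with 0 < n: the library's measurable types are
   nonempty. *)
HB.instance Definition _ (n : nat) := isPointed.Build 'I_n.+1 ord0.
HB.instance Definition _ (n : nat) :=
  @isMeasurable.Build default_measure_display 'I_n.+1
    (@discrete_measurable 'I_n.+1) (@discrete_measurable0 _)
    (@discrete_measurableC _) (@discrete_measurableU _).

(* The vertices of the matching poset with n.+1 edges (v_i, u_i). *)
Definition matching_vertex (n : nat) : Type := ('I_n.+1 + 'I_n.+1)%type.

Definition vertex_u (n : nat) (i : 'I_n.+1) : matching_vertex n := inl i.
Definition vertex_v (n : nat) (i : 'I_n.+1) : matching_vertex n := inr i.

HB.instance Definition _ (n : nat) := Finite.on (matching_vertex n).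
HB.instance Definition _ (n : nat) :=
  isPointed.Build (matching_vertex n) (vertex_u ord0).
HB.instance Definition _ (n : nat) :=
  @isMeasurable.Build default_measure_display (matching_vertex n)
    (@discrete_measurable (matching_vertex n)) (@discrete_measurable0 _)
    (@discrete_measurableC _) (@discrete_measurableU _).

(* [pprobability V R] is the library's measurable space of probability measures
   on V, so that a distribution over distributions on V is an element of
   [probability (pprobability V R) R]. *)
Notation dist V R := (pprobability V R).
Notation dist_over_dist V R := (probability (pprobability V R) R).

Section distributions.
Context (d : measure_display) (V : finMeasurableType d) (R : realType).

Definition prob_at (p : dist V R) (x : V) : R :=
  fine ((p : probability V R) [set x]).

Definition dTV (p q : dist V R) : R :=
  2^-1 * \sum_(x : V) `|prob_at p x - prob_at q x|.

Definition eps_far (C : set (dist V R)) (eps : R) (p : dist V R) : Prop :=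
  forall q, C q -> eps <= dTV p q.

Definition prob_le (pmax : R) (p : dist V R) : Prop :=
  forall x, prob_at p x <= pmax.

Definition dsupport (N : dist_over_dist V R) : set (dist V R) :=
  [set p | forall r : R, 0 < r -> (0 < N [set p' | (dTV p p' < r)%R])%E].

(* A randomized algorithm drawing k samples, given by its probability of
   accepting (over its internal randomness) on each tuple of samples. *)
Record algorithm (k : nat) := Algorithm {
  accept_on :> k.-tuple V -> R;
  accept_on01 : forall x, 0 <= accept_on x <= 1 }.

(* The probability of acceptance on k independent samples from p. *)
Definition accept_prob (k : nat) (A : algorithm k) (p : dist V R) : R :=
  \sum_(x : k.-tuple V) (\prod_(j < k) prob_at p (tnth x j)) * A x.

Definition reject_prob (k : nat) (A : algorithm k) (p : dist V R) : R :=
  1 - accept_prob A p.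

Definition distinguishes (Np Nm : dist_over_dist V R) (delta : R) (k : nat)
    (A : algorithm k) : Prop :=
  (delta%:E <= \int[Np]_p (accept_prob A p)%:E)%E /\
  (delta%:E <= \int[Nm]_p (reject_prob A p)%:E)%E.

(* The probability, over p drawn from N, the k samples from p and the coins
   of A, that A accepts while p is in C or rejects while p is eps-far
   from C. *)
Definition test_success (C : set (dist V R)) (eps : R)
    (N : dist_over_dist V R) (k : nat) (A : algorithm k) : \bar R :=
  (\int[N]_(p in C) (accept_prob A p)%:E +
   \int[N]_(p in eps_far C eps) (reject_prob A p)%:E)%E.

End distributions.

Definition T_big (R : realType) (n : nat) (T : R) : set (dist 'I_n.+1 R) :=
  [set p | forall i, T <= prob_at p i].

Definition matching_monotone (R : realType) (n : nat) :
    set (dist (matching_vertex n) R) :=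
  [set q | forall i : 'I_n.+1, prob_at q (vertex_v i) <= prob_at q (vertex_u i)].

(* Main.v *)
Require Import Defs.
From HB Require Import structures.
From mathcomp Require Import all_boot all_order all_algebra.
From mathcomp Require Import all_classical all_reals all_analysis.
From mathcomp Require Import measurable_realfun ring lra.

(** Embed a distribution p on the n edges of the matching as q(u_i) = p_i / Z,
    q(v_i) = T / Z with Z = 1 + T n in [1, 2].  Then q is monotone iff p is
    T-big.  When T n <= 1, the distance of p to T-bigness is exactly the deficit
    sum_i (T - p_i)^+, and every monotone distribution is at distance at least
    deficit / (2 Z) from q, which gives eps' = eps / 4.  A sample of q is
    obtained from a sample of p by a Markov kernel, so a tester for q yields a
    distinguisher for p with the same number of samples.

    The even mixture of the images of N^+ and N^- does not suffice: a tester may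
    succeed with probability 2/3 on average while failing on one of the two
    sides.  But the pairs of success probabilities reachable with fewer than s
    samples form a convex compact set that misses the quadrant [2/3, 1]^2, so
    some weight w puts w a + (1 - w) b < 2/3 on all of them; the weights
    (w, 1 - w) give a mixture on which no s - 1 samples suffice. *)

Set Implicit Arguments.
Unset Strict Implicit.

Import Order.TTheory GRing.Theory Num.Theory.

Local Open Scope classical_set_scope.
Local Open Scope ring_scope.

(** * Minimax weight for tests on a finite set *)

Section minimax.
Context (R : realFieldType) (X : finType) (P Q : X -> R).

Let acc (A : X -> R) := \sum_x P x * A x.
Let rej (A : X -> R) := \sum_x Q x * (1 - A x).

Let acc_mix t A B : acc (fun x => t * A x + (1 - t) * B x) =
  t * acc A + (1 - t) * acc B.
Proof. by rewrite /acc !mulr_sumr -big_split; apply: eq_bigr => x _ /=; ring. Qed.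

Let rej_mix t A B : rej (fun x => t * A x + (1 - t) * B x) =
  t * rej A + (1 - t) * rej B.
Proof. by rewrite /rej !mulr_sumr -big_split; apply: eq_bigr => x _ /=; ring. Qed.

(* Deterministic tests are sets, so only finitely many conditions on the weight
   w occur: each is an upper bound or a lower bound, and an upper bound below a
   lower bound would yield, by mixing the two tests, one that meets delta on
   both sides. *)
Lemma minimax_weight (delta : R) : 0 < delta < 1 ->
  \sum_x P x = 1 -> \sum_x Q x = 1 ->
  (forall A : X -> R, (forall x, 0 <= A x <= 1) ->
     ~ (delta <= \sum_x P x * A x /\ delta <= \sum_x Q x * (1 - A x))) ->
  exists2 w : R, 0 <= w <= 1 &
    forall A : X -> R, (forall x, 0 <= A x <= 1) ->
      w * (\sum_x P x * A x) + (1 - w) * (\sum_x Q x * (1 - A x)) < delta.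
Proof.
move=> /andP[d0 d1] P1 Q1 noA.
pose ind (S : {set X}) (x : X) : R := (x \in S)%:R.
have ind01 S x : 0 <= ind S x <= 1.
  by rewrite /ind; case: (x \in S); rewrite ?lexx ?ler01.
pose a S := acc (ind S); pose b S := rej (ind S).
have ab S : ~ (delta <= a S /\ delta <= b S) by apply: noA.
(* Always accepting and always rejecting make the two families of sets optimized over below
   nonempty. *)
have aT : delta <= a [set: X]%SET.
  rewrite /a /acc (eq_bigr P) ?P1 1?ltW// => x _.
  by rewrite /ind finset.in_setT mulr1.
have b0 : delta <= b finset.set0.
  rewrite /b /rej (eq_bigr Q) ?Q1 1?ltW// => x _.
  by rewrite /ind finset.in_set0 subr0 mulr1.
(* Both quotients are the weight at which [w * a S + (1 - w) * b S] equals [delta]. The payoff is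
   below [delta] for [w < al S] when [a S] reaches [delta], and for [w > be S] when [b S] does. *)
pose al S := (delta - b S) / (a S - b S).
pose be S := (b S - delta) / (b S - a S).
have abl S : delta <= a S -> b S < delta.
  by move=> h; rewrite ltNge; apply/negP => h'; exact: (ab S).
have bal S : delta <= b S -> a S < delta.
  by move=> h; rewrite ltNge; apply/negP => h'; exact: (ab S).
case: (@Order.TotalTheory.arg_minP _ _ _ [set: X]%SET
  (fun S => delta <= a S) al aT) => S1 aS1 minS1.
case: (@Order.TotalTheory.arg_maxP _ _ _ finset.set0
  (fun S => delta <= b S) be b0) => S2 bS2 maxS2.
have bS1 := abl _ aS1; have aS2 := bal _ bS2.
have lt21 : be S2 < al S1.
  rewrite ltNge; apply/negP.
  rewrite /al /be ler_pdivrMr ?subr_gt0; last lra.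
  rewrite mulrAC ler_pdivlMr ?subr_gt0; last lra.
  (* [t] makes the acceptance of the mixed test exactly [delta]; then [h], the wrong order of the
     two crossing weights, puts its rejection at [delta] or above. *)
  move=> h; pose t := (delta - a S2) / (a S1 - a S2).
  have t0 : 0 <= t by rewrite divr_ge0; lra.
  have t1 : t <= 1 by rewrite ler_pdivrMr; lra.
  apply: (noA (fun x => t * ind S1 x + (1 - t) * ind S2 x)).
    move=> x; have /andP[? ?] := ind01 S1 x; have /andP[? ?] := ind01 S2 x.
    by apply/andP; split; nra.
  rewrite -/(acc _) -/(rej _) acc_mix rej_mix -/(a _) -/(a _) -/(b _) -/(b _).
  have tE : t * (a S1 - a S2) = delta - a S2 by rewrite /t divfK//; lra.
  split; first lra.
  rewrite -(ler_pM2r (_ : 0 < a S1 - a S2)); last lra.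
  have -> : (t * b S1 + (1 - t) * b S2) * (a S1 - a S2) =
    b S2 * (a S1 - a S2) + (b S1 - b S2) * (t * (a S1 - a S2)) by ring.
  rewrite tE; nra.
have be0 : 0 <= be S2 by rewrite divr_ge0; lra.
have al1 : al S1 <= 1 by rewrite ler_pdivrMr; lra.
pose w := (be S2 + al S1) / 2.
have w01 : 0 <= w <= 1 by rewrite /w; lra.
have wab S : w * a S + (1 - w) * b S < delta.
  have [h|h] := leP delta (a S).
    have hb := abl _ h.
    have : w < al S by apply: lt_le_trans (minS1 _ h); rewrite /w; lra.
    by rewrite /al ltr_pdivlMr ?subr_gt0 => [?|]; lra.
  have [h'|h'] := leP delta (b S).
    have : be S < w by apply: (le_lt_trans (maxS2 _ h')); rewrite /w; lra.
    have ha := bal _ h'.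
    by rewrite /be ltr_pdivrMr ?subr_gt0 => [?|]; lra.
  case/andP: w01 => w0 w1.
  (* A convex combination of two numbers below [delta]; the split picks out a weight that is
     certainly positive. *)
  have [wle|wgt] := leP w (1 / 2).
    have := mulr_ge0 w0 (ltW (_ : 0 < delta - a S)).
    have := mulr_gt0 (_ : 0 < 1 - w) (_ : 0 < delta - b S).
    by move=> /(_ ltac:(lra) ltac:(lra)) ? /(_ ltac:(lra)) ?; lra.
  have := mulr_gt0 (_ : 0 < w) (_ : 0 < delta - a S).
  have := mulr_ge0 (_ : 0 <= 1 - w) (_ : 0 <= delta - b S).
  by move=> /(_ ltac:(lra) ltac:(lra)) ? /(_ ltac:(lra) ltac:(lra)) ?; lra.
exists w => // A A01.
(* The Bayes test: the payoff is affine in each [A x], so it is largest when accepting exactly where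
   [w * P x] dominates. *)
pose S := [set x | (1 - w) * Q x <= w * P x]%SET.
apply: le_lt_trans (wab S); rewrite /a /b /acc /rej.
rewrite !mulr_sumr -!big_split; apply: ler_sum => x _ /=.
rewrite /ind inE; have /andP[A0 A1] := A01 x.
case: (leP ((1 - w) * Q x) (w * P x)) => h; rewrite ?mulr1n ?mulr0n.
  have : 0 <= (w * P x - (1 - w) * Q x) * (1 - A x).
    by rewrite mulr_ge0 // subr_ge0.
  by move=> ?; lra.
have : 0 <= ((1 - w) * Q x - w * P x) * A x by rewrite mulr_ge0 // subr_ge0 ltW.
by move=> ?; lra.
Qed.

End minimax.

(** * Sums of products over tuples *)

Section tuples.
Context (R : comNzRingType) (V : finType).

Lemma sum_tupleS (k : nat) (F : k.+1.-tuple V -> R) :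
  \sum_x F x = \sum_v \sum_(t : k.-tuple V) F [tuple of v :: t].
Proof.
rewrite pair_big /= (reindex (fun p : V * k.-tuple V => [tuple of p.1 :: p.2])) //.
exists (fun x : k.+1.-tuple V => (thead x, [tuple of behead x])) => x _ /=.
  by case: x => v t; rewrite theadE; congr pair; apply: val_inj.
by rewrite -tuple_eta.
Qed.

Lemma prod_tupleS (k : nat) (F : 'I_k.+1 -> V -> R) (v : V) (t : k.-tuple V) :
  \prod_(j < k.+1) F j (tnth [tuple of v :: t] j) =
  F ord0 v * \prod_(j < k) F (lift ord0 j) (tnth t j).
Proof.
by rewrite big_ord_recl tnth0; congr (_ * _); apply: eq_bigr => j _; rewrite tnthS.
Qed.

(** The factor may depend on the position [j]: in the simulation it carries a fixed outcome at that
    position. *)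
Lemma sum_tuple_prod (k : nat) (F : 'I_k -> V -> R) :
  \sum_(x : k.-tuple V) \prod_(j < k) F j (tnth x j) =
  \prod_(j < k) \sum_v F j v.
Proof.
elim: k F => [|k IH] F.
  rewrite big_ord0 (big_pred1 [tuple]) ?big_ord0 // => x.
  by apply/esym/eqP; exact: tuple0.
rewrite sum_tupleS big_ord_recl -IH big_distrl /=; apply: eq_bigr => v _.
by rewrite big_distrr; apply: eq_bigr => t _; rewrite prod_tupleS.
Qed.

End tuples.

(** * Mixtures of pushforward measures *)

Section mixtures.
Context (R : realType) (d1 d2 : measure_display).
Context (T1 : measurableType d1) (T2 : measurableType d2).

(** Normalizing by the mass 1 changes no value, and [mnormalize] is a bundled probability. *)
Lemma probability_of_mass1 (mu : {measure set T2 -> \bar R}) :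
  mu [set: T2] = 1%E ->
  exists P : probability T2 R, (P : set T2 -> \bar R) = mu.
Proof.
move=> mu1; exists (mnormalize mu point); apply/funext => A.
by rewrite /= /mnormalize mu1 /= onee_eq0 /= invr1 mule1.
Qed.

Lemma pushforward_mixture_exists (f : T1 -> T2) (mu nu : probability T1 R) (w : R) :
  measurable_fun setT f -> 0 <= w <= 1 ->
  exists D : probability T2 R,
    (forall A, D A = w%:E * mu (f @^-1` A) + (1 - w)%:E * nu (f @^-1` A))%E /\
    (forall A (g : T2 -> \bar R), measurable A -> measurable_fun A g ->
      (forall x, 0 <= g x)%E ->
      \int[D]_(x in A) g x = w%:E * \int[mu]_(x in f @^-1` A) g (f x) +
        (1 - w)%:E * \int[nu]_(x in f @^-1` A) g (f x))%E.
Proof.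
move=> mf /andP[w0 w1].
have w1' : 0 <= 1 - w by rewrite subr_ge0.
pose m1 : {measure set T2 -> \bar R} := pushforward mu f.
pose m2 : {measure set T2 -> \bar R} := pushforward nu f.
pose s1 : {measure set T2 -> \bar R} := mscale (NngNum w0) (m1 mf).
pose s2 : {measure set T2 -> \bar R} := mscale (NngNum w1') (m2 mf).
pose m : {measure set T2 -> \bar R} := measure_add s1 s2.
have mE A : (m A = w%:E * mu (f @^-1` A) + (1 - w)%:E * nu (f @^-1` A))%E.
  exact: measure_addE.
have mT : m setT = 1%E.
  rewrite mE preimage_setT !probability_setT !mule1 -EFinD.
  by congr EFin; ring.
have [D DE] := probability_of_mass1 mT.
exists D; split=> [A|A g mA mg g0]; first by rewrite DE mE.
rewrite DE (_ : (m : set T2 -> \bar R) = measure_add s1 s2) //.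
rewrite ge0_integral_measure_add // !ge0_integral_mscale //.
by rewrite !ge0_integral_pushforward // => ? _; exact: g0.
Qed.

End mixtures.

(** * Distributions on a finite discrete space and their supports *)

Section finite_distributions.
Context (R : realType) (d : measure_display) (V : finMeasurableType d).
Hypothesis discreteV : forall A : set V, measurable A.
Implicit Types (p q : dist V R) (N : dist_over_dist V R).

Lemma prob_at_ge0 p x : 0 <= prob_at p x.
Proof. by rewrite /prob_at fine_ge0. Qed.

Lemma prob_atK p x : ((prob_at p x)%:E = (p : probability V R) [set x])%E.
Proof. by rewrite /prob_at fineK // fin_num_measure. Qed.

Lemma prob_sum p (U : set V) :
  ((p : probability V R) U = (\sum_(x | x \in U) prob_at p x)%:E)%E.
Proof.
have -> : (p : probability V R) U =
    (p : probability V R) (\bigcup_(x in U) [set x]).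
  by rewrite bigcup_imset1 image_id.
rewrite measure_fin_bigcup //; first last.
- by move=> x y _ _ [z [->]].
- exact: (@finite_finset V U).
rewrite (eq_fsbigl _ _ _ (esym (set_mem_set U))).
rewrite -(@bigfs _ _ _ _ (index_enum V)) ?index_enum_uniq //.
  by rewrite -sumEFin; apply: eq_bigr => x _; rewrite prob_atK.
by move=> x _; rewrite mem_index_enum.
Qed.

Lemma sum_prob_at p : \sum_x prob_at p x = 1.
Proof.
have := prob_sum p setT; rewrite probability_setT => /esym[] <-.
by apply: eq_bigl => x; rewrite in_setT.
Qed.

Lemma dist_exists (g : V -> R) : (forall x, 0 <= g x) -> \sum_x g x = 1 ->
  exists p : dist V R, forall x, prob_at p x = g x.
Proof.
move=> g0 g1.
pose m_ (i : nat) : {measure set V -> \bar R} :=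
  mscale (NngNum (g0 (nth point (enum V) i))) (dirac (nth point (enum V) i)).
pose m : {measure set V -> \bar R} := msum m_ #|V|.
have mE U : (m U = \sum_(x in V) (g x)%:E * \d_x U)%E.
  rewrite /m /msum /= -big_enum /= (big_nth point) big_mkord -cardE.
  by apply: eq_bigr.
have mT : m setT = 1%E.
  rewrite mE -g1 -sumEFin; apply: eq_bigr => x _.
  by rewrite diracT mule1.
have [p pE] := probability_of_mass1 mT.
exists p => x; rewrite /prob_at pE mE.
rewrite (bigD1 x) //= diracE in_set1 eqxx mule1 big1 ?adde0 // => y yx.
by rewrite diracE in_set1 /= (negbTE yx) mule0.
Qed.

(** The identity of [dist V R] is a probability kernel, and kernel measurability is that of
    evaluation on a set. *)
Lemma measurable_prob_at x : measurable_fun setT (fun p : dist V R => prob_at p x).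
Proof.
apply: measurableT_comp; first exact: fine_measurable.
exact: (measurable_kernel (kprobability (@measurable_id _ (dist V R) setT))).
Qed.

(** The sigma-algebra on [dist V R] is generated by the sets where the mass of some [U] is below
    some [r], and that mass is a finite sum of point masses. *)
Lemma measurable_fun_dist (d' : measure_display) (T : measurableType d')
    (f : T -> dist V R) :
  (forall x, measurable_fun setT (fun t => prob_at (f t) x)) ->
  measurable_fun setT f.
Proof.
move=> mf.
apply: (measurability (@pset _ _ _ : set (set (dist V R)))) => //.
move=> _ -[_ [r r01] [U mU <-]] <-; apply: emeasurable_fun_infty_o => //=.
apply: (eq_measurable_fun (fun t =>
    (\sum_x if x \in U then prob_at (f t) x else 0)%:E)).
  by move=> t _; rewrite prob_sum [in RHS]big_mkcond.
apply/measurable_EFinP; apply: measurable_sum => x.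
by case: (x \in U); [exact: mf|exact: measurable_cst].
Qed.

Lemma measurable_sublevel (d' : measure_display) (T : measurableType d') (f : T -> R) r :
  measurable_fun setT f -> measurable [set t | f t < r].
Proof.
move=> mf; have := mf measurableT `]-oo, r[%classic (measurable_itv _).
by rewrite setTI preimage_itvNyo.
Qed.

Lemma measurable_l1 (g : V -> R) :
  measurable_fun setT (fun p => \sum_x `|g x - prob_at p x|).
Proof.
apply: measurable_sum => x; apply: measurableT_comp; first exact: normr_measurable.
by apply: measurable_funB => //; exact: measurable_prob_at.
Qed.

Lemma measurable_dTV_ball p r : measurable [set p' | dTV p p' < r].
Proof.
apply: measurable_sublevel; apply: measurable_funM => //; exact: measurable_l1.
Qed.

Lemma measurable_accept_prob (k : nat) (A : algorithm V R k) :
  measurable_fun setT (accept_prob A).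
Proof.
apply: measurable_sum => x; apply: measurable_funM => //.
by apply: measurable_prod => j _; exact: measurable_prob_at.
Qed.



(* Balls with rational centre and radius form a countable base, so the null
   balls are covered by countably many null sets. *)
Lemma negligible_dsupportC N : N.-negligible (~` dsupport N).
Proof.
pose B (c : {ffun V -> rat} * rat) :=
  [set p : dist V R | \sum_x `|ratr (c.1 x) - prob_at p x| < ratr c.2].
have mB c : measurable (B c) by apply: measurable_sublevel; exact: measurable_l1.
pose F n := if unpickle n is Some c then
  (if N (B c) == 0%E then B c else set0) else set0.
apply: (@negligibleS _ _ _ _ (\bigcup_n F n)); last first.
  apply: negligible_bigcup => n; rewrite /F; case: (unpickle n) => [c|].
    case: ifPn => [/eqP N0|_]; last exact: negligible_set0.
    by exists (B c); split.
  exact: negligible_set0.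
move=> p /=; rewrite /dsupport /= => /existsNP[r /not_implyP[r0 Nr]].
have e0 : 0 < r / (#|V|.+1)%:R by rewrite divr_gt0 // ltr0n.
have cV x : {c : rat | `|ratr c - prob_at p x| < r / (#|V|.+1)%:R / 2}.
  apply: cid; have e2 : 0 < r / (#|V|.+1)%:R / 2 by rewrite divr_gt0.
  have [c] := @rat_in_itvoo R (prob_at p x) (prob_at p x + r / (#|V|.+1)%:R / 2)
    ltac:(by rewrite ltrDl).
  rewrite in_itv /= => /andP[h1 h2]; exists c.
  by rewrite ger0_norm ?subr_ge0 ?(ltW h1) // ltrBlDl.
(* The l1 distance from [p] to the rational centre is at most [r / 2 < s]. As [dTV] is half the l1
   distance, two points of the ball of radius [s] are within [s < r]. *)
have [s] := @rat_in_itvoo R (r / 2) r ltac:(lra).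
rewrite in_itv /= => /andP[hs1 hs2].
pose g : {ffun V -> rat} := [ffun x => sval (cV x)].
have Bp : B (g, s) p.
  rewrite /B /=; apply: le_lt_trans hs1.
  apply: (@le_trans _ _ (\sum_(x : V) r / (#|V|.+1)%:R / 2)).
    by apply: ler_sum => x _; rewrite ffunE; case: (cV x) => c /= /ltW.
  rewrite sumr_const (_ : #|_| = #|V|) // -[_ *+ #|V|]mulr_natr.
  have -> : r / (#|V|.+1)%:R / 2 * #|V|%:R = r / 2 * (#|V|%:R / (#|V|.+1)%:R).
    by ring.
  rewrite ger_pMr ?divr_gt0 // ler_pdivrMr ?ltr0n // mul1r ler_nat.
  exact: leqnSn.
exists (pickle (g, s)) => //; rewrite /F pickleK ifT //.
have sub : B (g, s) `<=` [set p' | dTV p p' < r].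
  move=> p' Bp' /=; apply: le_lt_trans hs2; rewrite /dTV mulrC.
  rewrite ler_pdivrMr // mulr_natr mulr2n.
  apply: le_trans (lerD (ltW Bp) (ltW Bp')); rewrite -big_split /=.
  apply: ler_sum => x _; apply: le_trans (ler_distD (ratr (g x)) _ _) _.
  by rewrite distrC.
rewrite -measure_le0 leNgt; apply/negP => Npos; apply: Nr.
by apply: lt_le_trans Npos _; apply: le_measure;
  rewrite ?inE //; exact: measurable_dTV_ball.
Qed.

Lemma dsupport_nonempty N : exists p, dsupport N p.
Proof.
apply/not_existsP => N0; have : N setT = 0%E.
  apply: measure_negligible => //.
  by apply: negligibleS (negligible_dsupportC N) => p _; exact: N0.
by rewrite probability_setT => /eqP; rewrite onee_eq0.
Qed.

(** Turns the hypotheses on supports into null events, as the complement of the support is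
    negligible. *)
Lemma dsupport_null N (A : set (dist V R)) : measurable A ->
  (forall p, dsupport N p -> ~ A p) -> N A = 0%E.
Proof.
move=> mA sA; apply: measure_negligible => //.
by apply: negligibleS (negligible_dsupportC N) => p Ap /sA; exact.
Qed.

End finite_distributions.

(** * Algorithms, their averaged behaviour and the choice of the weight *)

Section algorithms.
Context (R : realType) (d : measure_display) (V : finMeasurableType d).
Hypothesis discreteV : forall A : set V, measurable A.
Implicit Types (p q : dist V R) (N : dist_over_dist V R).

Lemma sum_prob_tuple (k : nat) p :
  \sum_(x : k.-tuple V) \prod_(j < k) prob_at p (tnth x j) = 1.
Proof.
rewrite (sum_tuple_prod (fun _ => prob_at p)) big1 // => j _.
exact: sum_prob_at.
Qed.

Lemma prod_prob_at_ge0 (k : nat) p (x : k.-tuple V) :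
  0 <= \prod_(j < k) prob_at p (tnth x j).
Proof. by apply: prodr_ge0 => j _; exact: prob_at_ge0. Qed.

Lemma accept_prob_ge0 (k : nat) (A : algorithm V R k) p : 0 <= accept_prob A p.
Proof.
apply: sumr_ge0 => x _; apply: mulr_ge0; first exact: prod_prob_at_ge0.
by have /andP[] := accept_on01 A x.
Qed.

(** Since the tuple weights sum to 1, rejecting is accepting with the opposite verdicts, so facts on
    acceptance carry over to rejection. *)
Lemma compl_algorithm (k : nat) (A : algorithm V R k) :
  exists2 B : algorithm V R k, (forall x, B x = 1 - A x) &
    forall p, accept_prob B p = reject_prob A p.
Proof.
have B01 x : 0 <= 1 - A x <= 1 by have := accept_on01 A x; lra.
exists (Algorithm B01) => // p.
rewrite /reject_prob /accept_prob -[X in X - _](sum_prob_tuple k p) -sumrB.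
by apply: eq_bigr => x _ /=; ring.
Qed.

Lemma reject_prob_ge0 (k : nat) (A : algorithm V R k) p : 0 <= reject_prob A p.
Proof.
by have [B _ BE] := compl_algorithm A; rewrite -BE accept_prob_ge0.
Qed.

Lemma measurable_reject_prob (k : nat) (A : algorithm V R k) :
  measurable_fun setT (reject_prob A).
Proof.
by apply: measurable_funB => //; exact: measurable_accept_prob.
Qed.

(** Additional samples can be ignored; they are added one at a time at the head of the tuple. *)
Lemma extend_algorithm (k m : nat) (A : algorithm V R k) : (k <= m)%N ->
  exists B : algorithm V R m, forall p, accept_prob B p = accept_prob A p.
Proof.
move=> /subnK <-; elim: (m - k)%N => [|l [B BE]]; first by exists A.
rewrite addSn.
have B01 (x : (l + k).+1.-tuple V) : 0 <= B [tuple of behead x] <= 1.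
  exact: accept_on01.
exists (Algorithm B01) => p; rewrite -BE -[RHS]mul1r -(sum_prob_at _ p) //.
rewrite [LHS]sum_tupleS big_distrl; apply: eq_bigr => v _.
rewrite /= [in RHS]/accept_prob big_distrr; apply: eq_bigr => t _ /=.
rewrite mulrA; congr (_ * B _); last exact: val_inj.
exact: (prod_tupleS (fun _ => prob_at p)).
Qed.

(** [P] is the law of the [k] samples when their distribution is itself drawn from [N]. Averaging
    thus leaves a linear functional of the test on a finite set, as the minimax argument
    requires. *)
Lemma integral_accept_prob N (k : nat) : exists2 P : k.-tuple V -> R,
  \sum_x P x = 1 & forall A : algorithm V R k,
    (\int[N]_p (accept_prob A p)%:E = (\sum_x P x * A x)%:E)%E.
Proof.
pose F (x : k.-tuple V) p := \prod_(j < k) prob_at p (tnth x j).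
have mF x : measurable_fun setT (fun p => (F x p)%:E).
  apply/measurable_EFinP; apply: measurable_prod => j _.
  exact: measurable_prob_at.
have F0 x p : (0 <= (F x p)%:E)%E by rewrite lee_fin prod_prob_at_ge0.
have Fint1 : (\sum_(x : k.-tuple V) \int[N]_p (F x p)%:E = 1)%E.
  rewrite -ge0_integral_sum //.
  under eq_integral => p _ do rewrite sumEFin sum_prob_tuple.
  by rewrite integral_cst // mul1e; exact: (@probability_setT _ _ _ N).
have Ffin x : (\int[N]_p (F x p)%:E \is a fin_num)%E.
  have i0 y : (0 <= \int[N]_p (F y p)%:E)%E by exact: integral_ge0.
  rewrite ge0_fin_numE //; apply: (@le_lt_trans _ _ 1%E); last exact: ltry.
  by rewrite -Fint1 (bigD1 x) //= leeDl // sume_ge0.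
exists (fun x => fine (\int[N]_p (F x p)%:E)).
  apply: EFin_inj; rewrite -sumEFin -Fint1.
  by apply: eq_bigr => x _; rewrite fineK.
move=> A; rewrite -sumEFin.
under eq_integral => p _ do rewrite /accept_prob -sumEFin.
have A0 x : 0 <= A x by have /andP[] := accept_on01 A x.
rewrite ge0_integral_sum //.
- apply: eq_bigr => x _; under eq_integral => p _ do rewrite EFinM.
  rewrite (ge0_integralZr _ measurableT (mF x)) ?lee_fin // EFinM.
  by rewrite fineK //; exact: Ffin.
- move=> x; under eq_fun do rewrite EFinM.
  by apply: emeasurable_funM; [exact: mF|exact: measurable_cst].
- by move=> x p _; rewrite lee_fin mulr_ge0 // prod_prob_at_ge0.
Qed.

Lemma indistinguishable_weight (Np Nm : dist_over_dist V R) (delta : R) (s : nat) :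
  0 < delta < 1 ->
  (forall (k : nat) (A : algorithm V R k),
      (k < s)%N -> ~ distinguishes Np Nm delta A) ->
  exists2 w : R, 0 <= w <= 1 &
    forall (k : nat) (A : algorithm V R k), (k < s)%N ->
      (w%:E * \int[Np]_p (accept_prob A p)%:E +
       (1 - w)%:E * \int[Nm]_p (reject_prob A p)%:E < delta%:E)%E.
Proof.
(* For [s = 0] the claim is vacuous. Otherwise the new [s] is the largest allowed number of samples,
   and padding lets the weight found there serve every smaller [k]. *)
case: s => [|s] d01 noA; first by exists 0 => //; rewrite lexx ler01.
have [P P1 PE] := integral_accept_prob Np s.
have [Q Q1 QE] := integral_accept_prob Nm s.
have QE' (A : algorithm V R s) : (\int[Nm]_p (reject_prob A p)%:E =
    (\sum_x Q x * (1 - A x))%:E)%E.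
  have [B BA BE] := compl_algorithm A.
  under eq_integral => p _ do rewrite -BE.
  by rewrite QE; congr EFin; apply: eq_bigr => x _; rewrite BA.
have [|w w01 wA] := @minimax_weight _ _ P Q delta d01 P1 Q1.
  move=> A A01 [a b]; apply: (noA _ (Algorithm A01) (ltnSn s)).
  by split; rewrite ?PE ?QE' lee_fin.
exists w => // k A ks.
have [B BE] := extend_algorithm A ks.
under eq_integral => p _ do rewrite -BE.
under [X in (_ + _ * X)%E]eq_integral => p _ do rewrite /reject_prob -BE.
rewrite PE (QE' B) -!EFinM -EFinD lte_fin; apply: wA => x.
exact: accept_on01.
Qed.

End algorithms.

(** * Simulating samples through a Markov kernel *)

Section simulation.
Context (R : realType) (d d' : measure_display).
Context (V : finMeasurableType d) (W : finMeasurableType d').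
Context (K : V -> W -> R).
Hypothesis K_ge0 : forall v w, 0 <= K v w.
Hypothesis K_sum1 : forall v, \sum_w K v w = 1.

(** Each sample is replaced by an independent draw from its row of [K] before [A] is run; [b]
    averages over these draws, which count as internal coins. *)
Lemma simulate_algorithm (f : dist V R -> dist W R) :
  (forall p w, prob_at (f p) w = \sum_v prob_at p v * K v w) ->
  forall (k : nat) (A : algorithm W R k),
  exists B : algorithm V R k, forall p, accept_prob B p = accept_prob A (f p).
Proof.
move=> fE k A.
pose b (x : k.-tuple V) := \sum_(y : k.-tuple W)
  (\prod_(j < k) K (tnth x j) (tnth y j)) * A y.
have b01 x : 0 <= b x <= 1.
  have K0 (y : k.-tuple W) : 0 <= \prod_(j < k) K (tnth x j) (tnth y j).
    by apply: prodr_ge0.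
  apply/andP; split.
    apply: sumr_ge0 => y _; apply: mulr_ge0 => //.
    by have /andP[] := accept_on01 A y.
  have -> : 1 = \sum_(y : k.-tuple W) \prod_(j < k) K (tnth x j) (tnth y j).
    rewrite (sum_tuple_prod (fun j => K (tnth x j))) big1 //.
  apply: ler_sum => y _; rewrite ler_piMr //.
  by have /andP[] := accept_on01 A y.
exists (Algorithm b01) => p; rewrite /accept_prob /=.
under eq_bigr => x _ do rewrite /b big_distrr /=.
rewrite exchange_big /=; apply: eq_bigr => y _.
under eq_bigr => x _ do rewrite mulrA -big_split /=.
rewrite -big_distrl /=; congr (_ * _).
rewrite (sum_tuple_prod (fun j v => prob_at p v * K v (tnth y j))).
by apply: eq_bigr => j _; rewrite fE.
Qed.

End simulation.

(** * Integrals over nested sets, and the distance to bigness *)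

Lemma le_integral_subset (d : measure_display) (T : measurableType d)
    (R : realType) (mu : {measure set T -> \bar R}) (A B : set T)
    (f : T -> \bar R) :
  (forall x, 0 <= f x)%E -> A `<=` B ->
  (\int[mu]_(x in A) f x <= \int[mu]_(x in B) f x)%E.
Proof.
(* A nonnegative integral is a supremum over simple functions below the restricted integrand, so
   arbitrary sets are covered, among them the far set. *)
move=> f0 AB; rewrite !ge0_integralE //; apply: le_ereal_sup => _ [h hA <-].
exists h => // x; apply: (le_trans (hA x)); rewrite !patchE.
case: ifPn => [/set_mem/AB Bx|_]; first by rewrite mem_set.
by case: ifP.
Qed.

Lemma dist_ord_exists (R : realType) (n : nat) (g : 'I_n.+1 -> R) :
  (forall i, 0 <= g i) -> \sum_i g i = 1 ->
  exists p : dist 'I_n.+1 R, forall i, prob_at p i = g i.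
Proof. exact: dist_exists. Qed.

(** Filling every deficit with mass taken proportionally from the excesses above [T] yields a
    [T]-big distribution at distance at most the deficit. *)
Lemma eps_far_T_big_deficit (R : realType) (n : nat) (T eps : R)
    (p : dist 'I_n.+1 R) : 0 <= T <= n.+1%:R^-1 -> eps_far (T_big T) eps p ->
  eps <= \sum_i Num.max 0 (T - prob_at p i).
Proof.
move=> /andP[T0 Tn] far.
pose def := \sum_i Num.max 0 (T - prob_at p i).
pose exc := \sum_i Num.max 0 (prob_at p i - T).
have p1 : \sum_i prob_at p i = 1 by exact: sum_prob_at.
have def0 : 0 <= def by apply: sumr_ge0 => i _; rewrite le_max lexx.
have exc0 : 0 <= exc by apply: sumr_ge0 => i _; rewrite le_max lexx.
have le_de : def <= exc.
  have : exc - def = \sum_(i < n.+1) prob_at p i - \sum_(i < n.+1) T.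
    rewrite -!sumrB; apply: eq_bigr => i _.
    case: (leP 0 (T - prob_at p i)) => h1;
    case: (leP 0 (prob_at p i - T)) => h2; lra.
  rewrite p1 sumr_const card_ord -mulr_natr.
  have : T * n.+1%:R <= 1 by rewrite -ler_pdivlMr ?ltr0n // mul1r.
  lra.
(* The fraction of the excess to move. If [exc = 0] then [def = 0], and division by zero gives
   [l = 0], so [l * exc = def] still holds. *)
pose l := def / exc.
have l0 : 0 <= l by rewrite divr_ge0.
have lE : l * exc = def.
  have [e0|e0] := eqVneq exc 0; last by rewrite /l divfK.
  by apply: le_anti; move: le_de; rewrite e0 mulr0 def0.
have l1 : l <= 1.
  have [e0|e0] := eqVneq exc 0; first by rewrite /l e0 invr0 mulr0 ler01.
  by rewrite ler_pdivrMr ?mul1r // lt_def e0.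
pose g i := prob_at p i + Num.max 0 (T - prob_at p i) -
  l * Num.max 0 (prob_at p i - T).
have gT i : T <= g i.
  rewrite /g; case: (leP 0 (T - prob_at p i)) => h1;
  case: (leP 0 (prob_at p i - T)) => h2; nra.
have g0 i : 0 <= g i by apply: le_trans (gT i).
have g1 : \sum_i g i = 1.
  rewrite /g sumrB big_split /= -mulr_sumr p1 -/def -/exc lE; ring.
have [q qE] := dist_ord_exists g0 g1.
apply: le_trans (far q _) _ => [i|]; first by rewrite qE.
(* The l1 distance is at most the mass added plus the mass removed, each equal to [def]. *)
rewrite /dTV mulrC ler_pdivrMr // mulr_natr mulr2n -/def -{2}lE.
rewrite /def /exc mulr_sumr -big_split /=; apply: ler_sum => i _.
rewrite qE /g ler_norml.
case: (leP 0 (T - prob_at p i)) => h1;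
  case: (leP 0 (prob_at p i - T)) => h2; apply/andP; split; nra.
Qed.

(** * Embedding distributions on the edges into the matching poset *)

Section matching_embedding.
Context (R : realType) (n : nat) (T : R).
Hypothesis T01 : 0 <= T <= n.+1%:R^-1.

Let Z : R := 1 + T * n.+1%:R.

Let Z_bounds : 1 <= Z <= 2.
Proof.
case/andP: T01 => T0 T1; rewrite /Z.
have : 0 <= T * n.+1%:R by rewrite mulr_ge0.
have : T * n.+1%:R <= 1 by rewrite -ler_pdivlMr ?ltr0n // mul1r.
by move=> ? ?; lra.
Qed.

Let Z_gt0 : 0 < Z.
Proof. by case/andP: Z_bounds => h _; exact: lt_le_trans h. Qed.

(** Keep [i] as [u_i] with probability [1 / Z], and otherwise output a uniform [v_j]; the [v] side
    does not depend on [i]. *)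
Definition matching_kernel (i : 'I_n.+1) (y : matching_vertex n) : R :=
  match y with inl j => (i == j)%:R / Z | inr _ => T / Z end.

Let sum_matching (F : matching_vertex n -> R) :
  \sum_y F y = \sum_i F (vertex_u i) + \sum_i F (vertex_v i).
Proof. exact: big_sumType. Qed.

Let sum_T : \sum_(i < n.+1) T / Z = 1 - Z^-1.
Proof.
rewrite sumr_const card_ord -mulr_natr.
have Z0 : Z != 0 by rewrite gt_eqF.
have -> : T / Z * n.+1%:R = (Z - 1) / Z by rewrite /Z; ring.
by rewrite mulrBl divff // mul1r.
Qed.

Lemma matching_kernel_ge0 i y : 0 <= matching_kernel i y.
Proof.
case/andP: T01 => T0 _.
by case: y => j /=; rewrite divr_ge0 // ?ler0n // ltW.
Qed.

Lemma matching_kernel_sum1 i : \sum_y matching_kernel i y = 1.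
Proof.
rewrite sum_matching /= sum_T (bigD1 i) //= eqxx big1; last first.
  by move=> j ji; rewrite eq_sym (negbTE ji) mul0r.
by rewrite mul1r addr0 addrC subrK.
Qed.

Lemma matching_embedding_exists :
  exists f : dist 'I_n.+1 R -> dist (matching_vertex n) R,
  forall p y, prob_at (f p) y = \sum_i prob_at p i * matching_kernel i y.
Proof.
have ex p : exists q : dist (matching_vertex n) R,
    forall y, prob_at q y = \sum_i prob_at p i * matching_kernel i y.
  apply: dist_exists => // [y|].
    apply: sumr_ge0 => i _; apply: mulr_ge0; first exact: prob_at_ge0.
    exact: matching_kernel_ge0.
  rewrite exchange_big /= -[RHS](sum_prob_at _ p) //.
  by apply: eq_bigr => i _; rewrite -mulr_sumr matching_kernel_sum1 mulr1.
by exists (fun p => sval (cid (ex p))) => p; case: cid.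
Qed.

Context (f : dist 'I_n.+1 R -> dist (matching_vertex n) R).
Hypothesis fE : forall p y,
  prob_at (f p) y = \sum_i prob_at p i * matching_kernel i y.

Lemma matching_embedding_u p i : prob_at (f p) (vertex_u i) = prob_at p i / Z.
Proof.
rewrite fE (bigD1 i) //= eqxx mul1r big1 ?addr0 // => j ji.
by rewrite (negbTE ji) mul0r mulr0.
Qed.

Lemma matching_embedding_v p i : prob_at (f p) (vertex_v i) = T / Z.
Proof. by rewrite fE /= -mulr_suml sum_prob_at // mul1r. Qed.

Lemma measurable_matching_embedding : measurable_fun setT f.
Proof.
apply: measurable_fun_dist => // y.
under eq_fun do rewrite fE.
apply: measurable_sum => i; apply: measurable_funM => //.
exact: measurable_prob_at.
Qed.

Lemma matching_embedding_monotone p :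
  matching_monotone (f p) <-> T_big T p.
Proof.
by split=> h i; have := h i; rewrite matching_embedding_u matching_embedding_v
  ler_pM2r ?invr_gt0.
Qed.

(** On an edge with [p_i < T], a monotone [q] has its [v] mass at most its [u] mass, so the two
    deviations add up to at least [(T - p_i) / Z]. The 4 combines the half in [dTV] with
    [Z <= 2]. *)
Lemma matching_embedding_far eps p : eps_far (T_big T) eps p ->
  eps_far (@matching_monotone R n) (eps / 4) (f p).
Proof.
move=> /(eps_far_T_big_deficit T01) far q mono.
set def := \sum_i _ in far.
have def0 : 0 <= def by apply: sumr_ge0 => i _; rewrite le_max lexx.
apply: (@le_trans _ _ (def / 4)); first by rewrite ler_pM2r ?invr_gt0 ?ltr0n.
rewrite /dTV sum_matching -big_split /=.
have -> : def / 4 = 2^-1 * (def / 2) by lra.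
rewrite ler_pM2l ?invr_gt0 ?ltr0n //.
apply: (@le_trans _ _ (def / Z)).
  rewrite ler_wpM2l // lef_pV2 ?posrE ?ltr0n //; by case/andP: Z_bounds.
rewrite mulr_suml; apply: ler_sum => i _.
rewrite matching_embedding_u matching_embedding_v.
have := mono i; set a := prob_at q _; set b := prob_at q _ => ab.
have [h|h] := leP 0 (T - prob_at p i); last by rewrite mul0r addr_ge0.
rewrite mulrBl.
have h1 := ler_norm (T / Z - a).
have h2 : b - prob_at p i / Z <= `|prob_at p i / Z - b|.
  by rewrite distrC ler_norm.
by lra.
Qed.

Lemma matching_embedding_le pmax p : T <= pmax -> prob_le pmax p ->
  prob_le pmax (f p).
Proof.
move=> Tp pp; case/andP: T01 => T0 _; case/andP: Z_bounds => Z1 _.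
have divZ (x : R) : 0 <= x -> x / Z <= x.
  by move=> x0; rewrite ler_pdivrMr // ler_peMr.
case=> i; rewrite -/(vertex_u i) -/(vertex_v i).
  rewrite matching_embedding_u; apply: le_trans (pp i); apply: divZ.
  exact: prob_at_ge0.
by rewrite matching_embedding_v; apply: le_trans Tp; exact: divZ.
Qed.

Lemma dTV_matching_embedding p p' : dTV (f p) (f p') = dTV p p' / Z.
Proof.
rewrite /dTV sum_matching [X in _ + X]big1 ?addr0; last first.
  by move=> i _; rewrite !matching_embedding_v subrr normr0.
rewrite -mulrA mulr_suml; congr (_ * _); apply: eq_bigr => i _.
by rewrite !matching_embedding_u -mulrBl normrM [X in _ * X]gtr0_norm ?invr_gt0.
Qed.

(* The image of the embedding is closed, so a limit point of the pushed forward
   distributions is itself the image of a point of the support. *)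
Lemma dsupport_matching_embedding (N : dist_over_dist 'I_n.+1 R)
    (q : dist (matching_vertex n) R) :
  (forall r : R, 0 < r -> (0 < N [set p | (dTV q (f p) < r)%R])%E) ->
  exists2 p, dsupport N p & forall y, prob_at q y = prob_at (f p) y.
Proof.
move=> qN.
(* Every ball around [q] has positive mass after pullback, hence contains an image, and all images
   have mass [T / Z] at [v_i]. *)
have qv i : prob_at q (vertex_v i) = T / Z.
  apply/eqP; rewrite -subr_eq0 -normr_le0; apply/ler_addgt0Pr => e e0.
  rewrite add0r; have e2 : 0 < e / 2 by rewrite divr_gt0.
  have [p qp] : exists p, dTV q (f p) < e / 2.
    apply/not_existsP => no; have := qN _ e2.
    rewrite (_ : [set p | _] = set0) ?measure0 ?ltxx //.
    by rewrite -subset0 => p /=; exact: no.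
  rewrite -(matching_embedding_v p i); apply: ltW.
  move: qp; rewrite /dTV mulrC ltr_pM2r ?invr_gt0 ?ltr0n //.
  apply: le_lt_trans; rewrite (bigD1 (vertex_v i)) //= lerDl.
  by apply: sumr_ge0.
have Z0 : Z != 0 by rewrite gt_eqF.
have qu : \sum_i prob_at q (vertex_u i) = Z^-1.
  have := sum_prob_at _ q; rewrite sum_matching.
  under [X in _ + X]eq_bigr => i _ do rewrite qv.
  by rewrite sum_T => /(_ (fun=> Logic.I)); lra.
(* The preimage of [q] is its [u] part rescaled by [Z]. *)
have g0 i : 0 <= Z * prob_at q (vertex_u i).
  by rewrite mulr_ge0 ?prob_at_ge0 // ltW.
have g1 : \sum_i Z * prob_at q (vertex_u i) = 1.
  by rewrite -mulr_sumr qu divff.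
have [p pE] := dist_ord_exists g0 g1.
have qf y : prob_at q y = prob_at (f p) y.
  case: y => i; rewrite -/(vertex_u i) -/(vertex_v i).
    by rewrite matching_embedding_u pE mulrC mulKf.
  by rewrite qv matching_embedding_v.
exists p => // r r0.
have dE p' : dTV q (f p') = dTV p p' / Z.
  by rewrite -dTV_matching_embedding /dTV; under eq_bigr do rewrite qf.
rewrite (_ : [set p' | _] = [set p' | dTV q (f p') < r / Z]).
  by apply: qN; rewrite divr_gt0.
by apply/seteqP; split=> p' /=; rewrite dE ltr_pM2r ?invr_gt0.
Qed.

End matching_embedding.

(** * Measurability of monotonicity, supports of mixtures, and a bound on [pmax] *)

Lemma measurable_matching_monotone (R : realType) (n : nat) :
  measurable (@matching_monotone R n).
Proof.
pose S (i : 'I_n.+1) := ~` [set q : dist (matching_vertex n) R |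
  prob_at q (vertex_u i) - prob_at q (vertex_v i) < 0].
rewrite (_ : @matching_monotone R n = \bigcap_(i in setT) S i).
  apply: fin_bigcap_measurable; first exact: finite_finset.
  move=> i _; apply: measurableC; apply: measurable_sublevel.
  by apply: measurable_funB; exact: measurable_prob_at.
apply/seteqP; split=> q h i.
  by move=> _; rewrite /S /=; apply/negP; rewrite -leNgt subr_ge0; exact: h.
by have := h i Logic.I; rewrite /S /= => /negP; rewrite -leNgt subr_ge0.
Qed.

(** If each component had a null ball around [q], the ball of the smaller radius would be null for
    the mixture. *)
Lemma dsupport_pushforward_mixture (R : realType) (d d' : measure_display)
    (V : finMeasurableType d) (W : finMeasurableType d')
    (f : dist V R -> dist W R) (w : R) (M N : dist_over_dist V R)
    (D : dist_over_dist W R) (q : dist W R) :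
  (forall A : set W, measurable A) -> measurable_fun setT f ->
  (forall A, D A = w%:E * M (f @^-1` A) + (1 - w)%:E * N (f @^-1` A))%E ->
  dsupport D q ->
  (forall r : R, 0 < r -> (0 < M [set p | (dTV q (f p) < r)%R])%E) \/
  (forall r : R, 0 < r -> (0 < N [set p | (dTV q (f p) < r)%R])%E).
Proof.
move=> mW mf DE qD; pose S r := [set p | dTV q (f p) < r].
have mS r : measurable (S r).
  have mB : measurable [set p' | dTV q p' < r] by exact: measurable_dTV_ball.
  by have := mf measurableT _ mB; rewrite setTI.
apply: contrapT => /not_orP[/existsNP[r1 /not_implyP[r10 h1]]].
move=> /existsNP[r2 /not_implyP[r20 h2]].
pose r := Num.min r1 r2.
have r0 : 0 < r by rewrite lt_min r10.
have null (mu : dist_over_dist V R) r' : r <= r' -> ~ (0 < mu (S r'))%E ->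
    mu (S r) = 0%E.
  move=> rr' /negP; rewrite -leNgt => h; apply/eqP; rewrite -measure_le0.
  apply: le_trans h; apply: le_measure; rewrite ?inE // => p /=.
  by move=> /lt_le_trans; exact.
have := qD _ r0; rewrite DE (null M r1) ?ge_min ?lexx //.
by rewrite (null N r2) ?ge_min ?lexx ?orbT // !mule0 adde0 ltxx.
Qed.

(** By averaging; this supplies [T <= pmax] and [0 <= pmax] in the theorem. *)
Lemma prob_ge_inv (R : realType) (n : nat) (pmax : R) (p : dist 'I_n.+1 R) :
  prob_le pmax p -> n.+1%:R^-1 <= pmax.
Proof.
move=> pp; rewrite -div1r ler_pdivrMr ?ltr0n // mulr_natr.
have <- : \sum_i prob_at p i = 1 by exact: sum_prob_at.
rewrite -[in leRHS](card_ord n.+1) -sumr_const; exact: ler_sum.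
Qed.

(** * The hard mixture and the sample lower bound *)

Unset Implicit Arguments.

Theorem theorem4 (R : realType) :
  exists c C : R, 0 < c /\ 0 < C /\
  forall (n : nat) (T eps pmax : R) (s : nat)
    (Np Nm : dist_over_dist 'I_n.+1 R),
    T <= n.+1%:R^-1 ->
    0 < eps ->
    (forall p, dsupport Np p -> T_big T p) ->
    (forall p, dsupport Nm p -> eps_far (T_big T) eps p) ->
    (forall p, dsupport Np p \/ dsupport Nm p -> prob_le pmax p) ->
    (forall (k : nat) (A : algorithm 'I_n.+1 R k),
        (k < s)%N -> ~ distinguishes Np Nm (2 / 3) A) ->
  exists (D : dist_over_dist (matching_vertex n) R)
    (pmax' eps' : R) (s' : nat),
    c * pmax <= pmax' <= C * pmax /\
    c * eps <= eps' <= C * eps /\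
    c * s%:R <= s'%:R /\
    (forall q, dsupport D q -> prob_le pmax' q) /\
    (forall q, dsupport D q -> matching_monotone q \/ eps_far (@matching_monotone R n) eps' q) /\
    (forall (k : nat) (A : algorithm (matching_vertex n) R k),
        ((2 / 3)%:E <= test_success (@matching_monotone R n) eps' D A)%E ->
        (s' <= k)%N).
Proof.
(* The 1/4 comes from [eps' = eps / 4]; [pmax] and [s] are kept unchanged. *)
exists (1 / 4), 1; split; [lra|split; first lra].
move=> n T eps pmax s Np Nm Tn eps0 bigNp farNm pmaxN noA.
have [p1 Np1] : exists p, dsupport Np p by exact: dsupport_nonempty.
have [p2 Nm2] : exists p, dsupport Nm p by exact: dsupport_nonempty.
have dTVpp (p : dist 'I_n.+1 R) : dTV p p = 0.
  by rewrite /dTV big1 ?mulr0 // => i _; rewrite subrr normr0.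
(* For negative [T] every distribution is [T]-big, so [p2] would be at distance at least [eps] from
   itself. *)
have T0 : 0 <= T.
  rewrite leNgt; apply/negP => T0.
  have : eps <= 0.
    rewrite -(dTVpp p2); apply: farNm => // i.
    by apply: le_trans (ltW T0) _; exact: prob_at_ge0.
  by rewrite leNgt eps0.
have T01 : 0 <= T <= n.+1%:R^-1 by rewrite T0.
have pn : n.+1%:R^-1 <= pmax by apply: (@prob_ge_inv _ _ _ p1); apply: pmaxN; left.
have pmax0 : 0 <= pmax by apply: le_trans pn; rewrite invr_ge0.
have [f fE] := matching_embedding_exists T01.
have mf := measurable_matching_embedding fE.
have d01 : 0 < (2 / 3 : R) < 1 by lra.
have [|w w01 wA] := indistinguishable_weight _ d01 noA.
  by [].
have [D [DE Dint]] := pushforward_mixture_exists Np Nm mf w01.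
have mW (A : set (matching_vertex n)) : measurable A by [].
have suppD q : dsupport D q -> exists2 p, dsupport Np p \/ dsupport Nm p &
    forall y, prob_at q y = prob_at (f p) y.
  move=> /(dsupport_pushforward_mixture mW mf DE).
  by case=> /(dsupport_matching_embedding T01 fE)[p Np' qf];
    exists p => //; [left|right].
exists D, pmax, (eps / 4), s; split; first lra.
split; first lra.
split; first by have := ler0n R s; lra.
split; [|split].
- move=> q /suppD[p Hp qf] y; rewrite qf.
  by apply: (matching_embedding_le T01 fE); [exact: le_trans pn|exact: pmaxN].
- move=> q /suppD[p [Hp|Hp] qf]; [left|right].
    move=> i; rewrite !qf; move: i.
    by apply/(matching_embedding_monotone T01 fE); exact: bigNp.
  move=> q' Hq'; rewrite (_ : dTV q q' = dTV (f p) q').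
    exact: (matching_embedding_far T01 fE (farNm _ Hp)).
  by rewrite /dTV; under eq_bigr do rewrite qf.
move=> k A; apply: contraTT; rewrite -ltnNge -ltNge => ks.
have [B BE] := simulate_algorithm (matching_kernel_ge0 T01)
  (matching_kernel_sum1 T01) fE A.
apply: le_lt_trans (wA k B ks).
pose mono := @matching_monotone R n.
have mmono : measurable mono := @measurable_matching_monotone R n.
have macc : measurable_fun setT (EFin \o accept_prob A).
  by apply/measurable_EFinP; exact: measurable_accept_prob.
have mrej : measurable_fun setT (EFin \o reject_prob A).
  by apply/measurable_EFinP; exact: measurable_reject_prob.
have acc0 q : (0 <= (accept_prob A q)%:E)%E by rewrite lee_fin accept_prob_ge0.
have rej0 q : (0 <= (reject_prob A q)%:E)%E by rewrite lee_fin reject_prob_ge0.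
(* Far distributions are not monotone, since [eps / 4 > 0]; enlarging the far set to the measurable
   complement allows the mixture formula. *)
apply: (@le_trans _ _ (\int[D]_(q in mono) (accept_prob A q)%:E +
    \int[D]_(q in ~` mono) (reject_prob A q)%:E)%E).
  rewrite /test_success leeD2l //; apply: le_integral_subset => // q far Cq.
  have : eps / 4 <= dTV q q by exact: far.
  rewrite /dTV big1 ?mulr0; first by lra.
  by move=> y _; rewrite subrr normr0.
rewrite !Dint //; [|exact: measurableC|exact: measurable_funTS|exact: measurable_funTS].
have mpre (S : set (dist (matching_vertex n) R)) : measurable S ->
    measurable (f @^-1` S).
  by move=> mS; have := mf measurableT _ mS; rewrite setTI.
(* Images from [Np] are almost surely monotone and those from [Nm] almost surely not, so two of the
   four integrals vanish; the others are bounded by the weighted success of [B]. *)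
have monoP p : mono (f p) <-> T_big T p.
  exact: (matching_embedding_monotone T01 fE).
have Np0 : Np (f @^-1` (~` mono)) = 0%E.
  apply: dsupport_null => //; first exact: mpre (measurableC mmono).
  by move=> p /bigNp big; apply; exact/monoP.
have Nm0 : Nm (f @^-1` mono) = 0%E.
  apply: dsupport_null => //; first exact: mpre.
  move=> p /farNm far /monoP big; have := far _ big.
  by rewrite dTVpp leNgt eps0.
have macc' : measurable_fun setT (fun p => (accept_prob A (f p))%:E).
  exact: (measurableT_comp macc mf).
have mrej' : measurable_fun setT (fun p => (reject_prob A (f p))%:E).
  exact: (measurableT_comp mrej mf).
rewrite (null_set_integral (mpre _ mmono) (measurable_funTS macc') Nm0).
rewrite (null_set_integral (mpre _ (measurableC mmono)) (measurable_funTS mrej') Np0).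
rewrite !mule0 adde0 add0e; case/andP: w01 => w0 w1.
under [X in (_ <= _ * X + _)%E]eq_integral => p _ do rewrite BE.
under [X in (_ <= _ + _ * X)%E]eq_integral => p _ do
  rewrite /reject_prob BE -/(reject_prob A (f p)).
by apply: leeD; apply: lee_wpmul2l; rewrite ?lee_fin ?subr_ge0 //;
  apply: le_integral_subset.
Qed.
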